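(* The family $E_{3f}=E_{3f}(e_1,e_3,e_5,e_6)$ admits a shift operator for every shift $(e_1,e_6)\to(e_1\pm1,e_6\pm1)$ (all four choices of signs), where the other free parameters $e_3,e_5$ are kept fixed.
   Context: Let $\partial=d/dx$ and $D=\mathbb{C}(x)[\partial]$. The operator $E_3(e)$: for $e=(e_1,\dots,e_7)$ with $e_1+\cdots+e_7=3$, put $$E_3(e)=x^2(x-1)^2\partial^3+x(x-1)(a_{21}x+a_{20})\partial^2+(a_{12}x^2+a_{11}x+a_{10})\partial+a_{01}x+A_{00}(e),$$ where $a_{21}=6-e_1-e_2-e_3-e_4$, $a_{20}=-3+e_1+e_2$, $a_{12}=(e_5+e_6+1)e_7+(e_6+1)(e_5+1)$, $a_{11}=-(e_5+e_6)e_7-e_1e_2+e_3e_4-e_5e_6+2e_1+2e_2-4$, $a_{10}=(e_1-1)(e_2-1)$, $a_{01}=e_5e_6e_7$, and $$\begin{aligned}54A_{00}(e)=&-4(e_1+e_2-e_3-e_4)^3-27e_5e_6e_7+9(e_1+e_2-e_3-e_4)(e_5e_6+e_5e_7+e_6e_7-2)\\&+9e_1e_2(e_1+e_2-1)+18(e_1+e_2-1)(e_3^2+e_3e_4+e_4^2)\\&-9e_3e_4(e_3+e_4-1)-18(e_3+e_4-1)(e_1^2+e_1e_2+e_2^2).\end{aligned}$$ $E_{3f}(e_1,e_3,e_5,e_6)$ is the specialization of $E_3(e)$ by $e_2=-e_1-e_3-e_5+1$, $e_4=e_3-e_5+1$ (and $e_7=3-(e_1+\cdots+e_6)$). Shift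 operators: let $E(p)$ be a family of third-order operators depending on parameters $p$, irreducible for generic $p$, and let $p\to p_+$ be a shift of the parameters by integers. A shift operator for this shift is a non-zero operator $P\in D$ of order lower than $3$, depending on $p$, sending the solution space of $E(p)$ to the solution space of $E(p_+)$; equivalently, there is $Q\in D$ with $E(p_+)\circ P=Q\circ E(p)$. The parameters are regarded as generic (indeterminates); the coefficients of $P$ are rational functions of $x$ and of $p$ (poles in $x$ are allowed; after normalization they may be taken polynomial in $p$ without common factor). *)

(* Defs.v *)
From mathcomp Require Import all_boot all_algebra.
From mathcomp Require Import generic_quotient fraction.
From mathcomp Require Import complex mpoly reals.

Set Implicit Arguments.
Unset Strict Implicit.
Unset Printing Implicit Defensive.

Import GRing.Theory.
Local Open Scope ring_scope.

Notation ratfun K := {fraction {poly K}}.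

(* A differential operator \sum_i a_i d^i in K(x)[d], d = d/dx, is stored as the
   polynomial \sum_i a_i *: 'X^i of its left coefficients.  Only the additive
   and left K(x)-linear structure of {poly ratfun K} is meaningful for operators;
   their product is dcomp, not the commutative product of {poly ratfun K}. *)
Notation diffop K := {poly ratfun K}.

Section DifferentialOperators.
Variable K : fieldType.

Definition rconst (c : K) : ratfun K := tofrac c%:P.

Definition rvar : ratfun K := tofrac 'X.

(* The quotient rule applied to a representing fraction of f. *)
Definition rderiv (f : ratfun K) : ratfun K :=
  let n := (frac (repr f)).1 in
  let d := (frac (repr f)).2 in
  tofrac (n^`() * d - n * d^`()) / tofrac (d ^+ 2).

Definition dpow (i : nat) : diffop K := 'X^i.

(* d o Q, computed from the rule d o b = b d + b'. *)
Definition dleft (Q : diffop K) : diffop K :=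
  \sum_(j < size Q) (Q`_j *: dpow j.+1 + rderiv Q`_j *: dpow j).

Definition dcomp (P Q : diffop K) : diffop K :=
  \sum_(i < size P) P`_i *: iter i dleft Q.

Definition is_shift_operator (E Eplus P : diffop K) : Prop :=
  [/\ P != 0,
      (size P <= 3)%N (* order lower than 3 *)
    & exists Q : diffop K, dcomp Eplus P = dcomp Q E].

Definition A00 (e1 e2 e3 e4 e5 e6 e7 : K) : K :=
  54%:R^-1 *
  (- (4%:R * (e1 + e2 - e3 - e4) ^+ 3) - 27%:R * e5 * e6 * e7
   + 9%:R * (e1 + e2 - e3 - e4) * (e5 * e6 + e5 * e7 + e6 * e7 - 2%:R)
   + 9%:R * e1 * e2 * (e1 + e2 - 1)
   + 18%:R * (e1 + e2 - 1) * (e3 ^+ 2 + e3 * e4 + e4 ^+ 2)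
   - 9%:R * e3 * e4 * (e3 + e4 - 1)
   - 18%:R * (e3 + e4 - 1) * (e1 ^+ 2 + e1 * e2 + e2 ^+ 2)).

Definition E3 (e1 e2 e3 e4 e5 e6 e7 : K) : diffop K :=
  let x := rvar in
  let a21 := 6%:R - e1 - e2 - e3 - e4 in
  let a20 := - 3%:R + e1 + e2 in
  let a12 := (e5 + e6 + 1) * e7 + (e6 + 1) * (e5 + 1) in
  let a11 := - ((e5 + e6) * e7) - e1 * e2 + e3 * e4 - e5 * e6
             + 2%:R * e1 + 2%:R * e2 - 4%:R in
  let a10 := (e1 - 1) * (e2 - 1) in
  let a01 := e5 * e6 * e7 in
  (x ^+ 2 * (x - 1) ^+ 2) *: dpow 3
  + (x * (x - 1) * (rconst a21 * x + rconst a20)) *: dpow 2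
  + (rconst a12 * x ^+ 2 + rconst a11 * x + rconst a10) *: dpow 1
  + (rconst a01 * x + rconst (A00 e1 e2 e3 e4 e5 e6 e7)) *: dpow 0.

Definition E3f (e1 e3 e5 e6 : K) : diffop K :=
  let e2 := - e1 - e3 - e5 + 1 in
  let e4 := e3 - e5 + 1 in
  let e7 := 3%:R - (e1 + e2 + e3 + e4 + e5 + e6) in
  E3 e1 e2 e3 e4 e5 e6 e7.

End DifferentialOperators.

(* The field C(p_0, p_1, p_2, p_3) of rational functions in four independent
   parameters, where C = R[i]. *)
Notation paramfield R := {fraction {mpoly R[i][4]}}.

Definition param (R : realType) (k : 'I_4) : paramfield R := tofrac 'X_k.

(* Main.v *)
(* The local exponents of E3f are {0, e1, e2} at 0, {0, e3, e4} at 1 and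
   {e5, e6, e7} at infinity, where e2 = 1 - e1 - e3 - e5 and
   e7 = 1 - e3 + e5 - e6, and E3f is invariant under e1 <-> e2 and under
   e6 <-> e7.  Raising e1 lowers e2 and raising e6 lowers e7, so these two
   symmetries reduce all four shifts to (e1, e6) -> (e1 + 1, e6 + 1).
   For that shift, the exponents force a second order operator P to be
     x (x-1)^2 d^2 + (x-1) ((1+e5+e6) x + e1 - 1) d + e5 e6 x + const,
   and the operator Q with E+ P = Q E has the same shape; comparing
   coefficients determines the two constants. *)
From HB Require Import structures.
Require Import Defs.
From mathcomp Require Import all_boot all_algebra fraction complex mpoly reals.
From mathcomp Require Import generic_quotient ring.
Import GRing.Theory.
Local Open Scope ring_scope.

(** With this morphism structure [ring] and [field] can expand [rconst] of a parameter
    expression. *)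
HB.instance Definition _ (K : fieldType) :=
  GRing.RMorphism.copy (@rconst K) (@FracField.tofrac {poly K} \o polyC).

(** Primed letters stand for derivatives but are free variables here, so [field] treats them as
    atoms. *)
Lemma quotient_rule_add (F : fieldType) (n d m c n' d' m' c' : F) :
  d != 0 -> c != 0 ->
  ((n' * c + n * c' + (m' * d + m * d')) * (d * c)
    - (n * c + m * d) * (d' * c + d * c')) / (d * c) ^+ 2 =
  (n' * d - n * d') / d ^+ 2 + (m' * c - m * c') / c ^+ 2.
Proof. by move=> d_neq0 c_neq0; field; rewrite d_neq0 c_neq0. Qed.

Lemma quotient_rule_mul (F : fieldType) (n d m c n' d' m' c' : F) :
  d != 0 -> c != 0 ->
  ((n' * m + n * m') * (d * c) - (n * m) * (d' * c + d * c')) / (d * c) ^+ 2 =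
  (n' * d - n * d') / d ^+ 2 * (m / c) + n / d * ((m' * c - m * c') / c ^+ 2).
Proof. by move=> d_neq0 c_neq0; field; rewrite d_neq0 c_neq0. Qed.

(** * Differentiation of rational functions *)

Section Derivation.
Variable K : fieldType.
Implicit Types (f g : ratfun K) (n d : {poly K}).

Lemma tofrac_neq0 d : d != 0 -> FracField.tofrac d != 0 :> ratfun K.
Proof. by rewrite tofrac_eq0. Qed.

Lemma frac_repr f :
  f = FracField.tofrac (frac (repr f)).1 / FracField.tofrac (frac (repr f)).2.
Proof.
rewrite -{1}[f]reprK; case: (repr f) => -[n d] /= d_neq0.
apply: (canRL (mulfK _)); first by rewrite tofrac_eq0.
unlock FracField.tofrac; rewrite !piE /FracField.mulf /=.
apply/eqmodP; rewrite /= FracField.equivfE.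
by rewrite !numden_Ratio ?mulf_neq0 ?oner_neq0 //= ?mulr1 mulrC.
Qed.

Lemma ratfunP f :
  exists n d, d != 0 /\ f = FracField.tofrac n / FracField.tofrac d.
Proof.
exists (frac (repr f)).1, (frac (repr f)).2; split; last exact: frac_repr.
exact: denom_ratioP.
Qed.

(** Independence of the representing fraction: if n/d = m/c, differentiate n c = m d. *)
Lemma rderiv_quot f n d : d != 0 ->
  f = FracField.tofrac n / FracField.tofrac d ->
  rderiv f = FracField.tofrac (n^`() * d - n * d^`()) / FracField.tofrac (d ^+ 2).
Proof.
move=> d_neq0 fE; rewrite /rderiv.
move: (frac_repr f) (denom_ratioP (repr f)).
case: (frac (repr f)) => m c /= E c_neq0.
have {}E : n * c = m * d.
  apply/eqP; rewrite -tofrac_eq !rmorphM /= -eqr_div ?tofrac_neq0 //.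
  by rewrite -fE E.
have E' : n^`() * c + n * c^`() = m^`() * d + m * d^`() by rewrite -!derivM E.
apply/eqP; rewrite eqr_div ?tofrac_neq0 ?expf_neq0 // -!rmorphM tofrac_eq.
(* The middle term is d c (n c)' - (n c) (d c)'. It is unchanged when (n, d) and (m, c) are
   exchanged, because n c = m d. *)
apply/eqP; transitivity (d * c * (n^`() * c + n * c^`()) - (n * c) * (d * c)^`()).
  by rewrite E' E derivM; ring.
by rewrite derivM; ring.
Qed.

Lemma rderivD f g : rderiv (f + g) = rderiv f + rderiv g.
Proof.
have [n [d [d_neq0 ->]]] := ratfunP f; have [m [c [c_neq0 ->]]] := ratfunP g.
rewrite (rderiv_quot (_ + _) (n * c + m * d) (d * c)) ?mulf_neq0 //; last first.
  by rewrite rmorphD !rmorphM /= addf_div ?tofrac_neq0.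
rewrite (rderiv_quot (_ / _) n d) // (rderiv_quot (_ / _) m c) //.
rewrite !(derivD, derivM) !(tofracB, tofracD, tofracM, tofracXn).
by apply: quotient_rule_add; rewrite tofrac_neq0.
Qed.

Lemma rderivM f g : rderiv (f * g) = rderiv f * g + f * rderiv g.
Proof.
have [n [d [d_neq0 ->]]] := ratfunP f; have [m [c [c_neq0 ->]]] := ratfunP g.
rewrite (rderiv_quot (_ * _) (n * m) (d * c)) ?mulf_neq0 //; last first.
  by rewrite !rmorphM mulf_div.
rewrite (rderiv_quot (_ / _) n d) // (rderiv_quot (_ / _) m c) //.
rewrite !(derivD, derivM) !(tofracB, tofracD, tofracM, tofracXn).
by apply: quotient_rule_mul; rewrite tofrac_neq0.
Qed.

Lemma rderiv_tofrac n : rderiv (FracField.tofrac n) = FracField.tofrac n^`().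
Proof.
rewrite (rderiv_quot _ n 1 (oner_neq0 _)) ?rmorph1 ?divr1 //.
by rewrite derivC mulr0 subr0 mulr1 expr1n rmorph1 divr1.
Qed.

Lemma rderiv_const (c : K) : rderiv (rconst c) = 0.
Proof. by rewrite rderiv_tofrac derivC rmorph0. Qed.

Lemma rderiv_var : rderiv (rvar K) = 1.
Proof. by rewrite rderiv_tofrac derivX rmorph1. Qed.

Lemma rderiv0 : rderiv (0 : ratfun K) = 0.
Proof. by rewrite -(rmorph0 (@rconst K)) rderiv_const. Qed.

Lemma rderiv1 : rderiv (1 : ratfun K) = 0.
Proof. by rewrite -(rmorph1 (@rconst K)) rderiv_const. Qed.

Lemma rderivN f : rderiv (- f) = - rderiv f.
Proof. by apply/eqP; rewrite -addr_eq0 -rderivD addNr rderiv0. Qed.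

Definition rderivE :=
  (rderiv0, rderiv1, rderiv_const, rderiv_var, rderivN, rderivD, rderivM).

(** * Coefficients of composed operators *)

Lemma coef_dleft (Q : diffop K) k :
  (dleft Q)`_k = (if k is j.+1 then Q`_j else 0) + rderiv Q`_k.
Proof.
(* The commutative product by ['X] is legitimate here: it only shifts the coefficients. *)
have E : dleft Q = Q * 'X + \poly_(j < size Q) rderiv Q`_j.
  rewrite /dleft big_split poly_def; congr (_ + _).
  rewrite -[X in _ = X * 'X]coefK poly_def mulr_suml; apply: eq_bigr => j _.
  by rewrite -scalerAl -exprSr.
rewrite E coefD coefMX coef_poly; case: ltnP => [_|/(nth_default _) ->].
  by case: k.
by rewrite rderiv0; case: k.
Qed.

(** A numeric bound lets the sum be unrolled without computing the exact size of [P]. *)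
Lemma dcomp_wide m (P Q : diffop K) : (size P <= m)%N ->
  dcomp P Q = \sum_(i < m) P`_i *: iter i (@dleft K) Q.
Proof.
move=> le_P_m; rewrite /dcomp.
rewrite -(big_mkord xpredT (fun i => P`_i *: iter i (@dleft K) Q)).
rewrite -(big_mkord xpredT (fun i => P`_i *: iter i (@dleft K) Q)).
rewrite [RHS](@big_cat_nat _ _ _ (size P)) //=.
rewrite [X in _ + X]big1_seq ?addr0 // => i /andP[_].
by rewrite mem_index_iota => /andP[/(nth_default _) -> _]; rewrite scale0r.
Qed.

Lemma E3_Poly (e1 e2 e3 e4 e5 e6 e7 : K) :
  let x := rvar K in
  E3 e1 e2 e3 e4 e5 e6 e7 = Poly [::
    rconst (e5 * e6 * e7) * x + rconst (A00 e1 e2 e3 e4 e5 e6 e7);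
    rconst ((e5 + e6 + 1) * e7 + (e6 + 1) * (e5 + 1)) * x ^+ 2
      + rconst (- ((e5 + e6) * e7) - e1 * e2 + e3 * e4 - e5 * e6
                + 2%:R * e1 + 2%:R * e2 - 4%:R) * x
      + rconst ((e1 - 1) * (e2 - 1));
    x * (x - 1) * (rconst (6%:R - e1 - e2 - e3 - e4) * x
                   + rconst (- 3%:R + e1 + e2));
    x ^+ 2 * (x - 1) ^+ 2].
Proof.
move=> x; apply/polyP => k; rewrite coef_Poly /E3 /dpow !(coefD, coefZ, coefXn).
by case: k => [|[|[|[|k]]]]; rewrite /= ?nth_nil !(mulr1, mulr0, add0r, addr0).
Qed.

(** * Shift operators of E3f *)

Section Shift.
Hypothesis K_pchar0 : [pchar K] =i pred0.

Let natr_neq0 m : (m.+1)%:R != 0 :> K.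
Proof. by rewrite ((pcharf0P K).1 K_pchar0). Qed.

(** On this specialization the bracket in [A00] is divisible by 27, so the denominator 54 drops to
    2. *)
Lemma A00_E3f (e1 e3 e5 e6 : K) :
  A00 e1 (- e1 - e3 - e5 + 1) e3 (e3 - e5 + 1) e5 e6 (1 - e3 + e5 - e6) =
  2%:R^-1 * (e5 * e6 * (e6 - e5 - 1) + e3 * e6 * (e6 + e3 - 1)
    + e1 * e5 * (e1 + e5 - 1) + e1 * e3 * (1 - e1 - e3)).
Proof. by rewrite /A00; field; rewrite !natr_neq0. Qed.

Local Notation c := (@rconst K).

Lemma E3f_Poly (e1 e3 e5 e6 : K) :
  let x := rvar K in
  E3f e1 e3 e5 e6 = Poly [::
    c (e5 * e6 * (1 - e3 + e5 - e6)) * x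
      + c (2%:R^-1 * (e5 * e6 * (e6 - e5 - 1) + e3 * e6 * (e6 + e3 - 1)
                      + e1 * e5 * (e1 + e5 - 1) + e1 * e3 * (1 - e1 - e3)));
    c ((e5 + e6 + 1) * (1 - e3 + e5 - e6) + (e6 + 1) * (e5 + 1)) * x ^+ 2
      + c (- ((e5 + e6) * (1 - e3 + e5 - e6)) + e1 * (e1 + e3 + e5 - 1)
           + e3 * (e3 - e5 + 1) - e5 * e6 - 2%:R * (e3 + e5 + 1)) * x
      + c ((1 - e1) * (e1 + e3 + e5));
    x * (x - 1) * (c (4%:R - e3 + 2%:R * e5) * x - c (2%:R + e3 + e5));
    x ^+ 2 * (x - 1) ^+ 2].
Proof.
move=> x; rewrite /E3f.
have -> : 3%:R - (e1 + (- e1 - e3 - e5 + 1) + e3 + (e3 - e5 + 1) + e5 + e6) =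
  1 - e3 + e5 - e6 by ring.
by rewrite E3_Poly A00_E3f; congr (Poly [:: _; _; _; _]); ring.
Qed.

Lemma shift_up_up (e1 e3 e5 e6 : K) :
  exists P, is_shift_operator (E3f e1 e3 e5 e6) (E3f (e1 + 1) e3 e5 (e6 + 1)) P.
Proof.
pose x := rvar K.
(* [g] is the sum of the two unknown constants of [P] and [Q]. Their difference e1 + e6 is forced by
   the coefficient of d^3, which involves them only through that difference. *)
pose g := e1 ^+ 2 + e6 ^+ 2 + e1 * e3 + e1 * e5 + e3 * e6 - e5 * e6
  + 2%:R * e1 * e6.
pose P : diffop K := Poly [:: c (e5 * e6) * x + c (2%:R^-1 * (g - e1 - e6));
  (x - 1) * (c (1 + e5 + e6) * x - c (1 - e1)); x * (x - 1) ^+ 2].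
(* Apart from its constant, [Q] is [P] with e1 and e6 raised by 1. *)
pose Q : diffop K := Poly [:: c (e5 * (e6 + 1)) * x + c (2%:R^-1 * (g + e1 + e6));
  (x - 1) * (c (2%:R + e5 + e6) * x + c e1); x * (x - 1) ^+ 2].
have size_Poly_le s : (size (Poly s : diffop K) <= size s)%N by exact: size_Poly.
exists P; split; last exists Q.
(* The d^2 coefficient x (x-1)^2 is non-zero whatever the parameters. *)
- apply/eqP => /(congr1 (fun p : diffop K => p`_2)); apply/eqP.
  rewrite coef0 coef_Poly /= mulf_neq0 ?expf_neq0 ?tofrac_neq0 ?polyX_eq0 //.
  by rewrite -(tofrac1 {poly K}) -tofracB tofrac_neq0 // -polyC1 polyXsubC_eq0.
- exact: size_Poly_le.
- rewrite !E3f_Poly -/x (dcomp_wide 4) ?size_Poly_le // (dcomp_wide 3) ?size_Poly_le //.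
  have coefP k : P`_k = _ := coef_Poly _ k.
  have coefQ k : Q`_k = _ := coef_Poly _ k.
  set E := Poly _; have coefE k : E`_k = _ := coef_Poly _ k.
  set E' := Poly _; have coefE' k : E'`_k = _ := coef_Poly _ k.
  (* Otherwise /= would unfold Poly into nested cons_poly. *)
  clearbody P Q E E'.
  rewrite !big_ord_recr !big_ord0 /= !add0r.
  apply/polyP => k; rewrite !(coefD, coefZ).
  have two_neq0 : 2%:R != 0 :> ratfun K.
    by rewrite -(rmorph_nat c) fmorph_eq0 natr_neq0.
  (* Both products have order at most 5, so six coefficients are compared and all later ones
     vanish. *)
  case: k => [|[|[|[|[|[|k]]]]]];
    do 2 rewrite ?(coef_dleft, coefP, coefE, coefQ, coefE') /=;
    rewrite ?nth_nil ?rderivE.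
  all: by rewrite /g; field; rewrite ?two_neq0.
Qed.

Lemma E3f_sym_e1 (e1 e3 e5 e6 : K) :
  E3f (1 - e1 - e3 - e5) e3 e5 e6 = E3f e1 e3 e5 e6.
Proof. by rewrite !E3f_Poly; congr (Poly [:: _; _; _; _]); ring. Qed.

Lemma E3f_sym_e6 (e1 e3 e5 e6 : K) :
  E3f e1 e3 e5 (1 - e3 + e5 - e6) = E3f e1 e3 e5 e6.
Proof. by rewrite !E3f_Poly; congr (Poly [:: _; _; _; _]); ring. Qed.

Lemma E3f_shift (s t : int) (e1 e3 e5 e6 : K) :
  s = 1 \/ s = -1 -> t = 1 \/ t = -1 ->
  exists P, is_shift_operator (E3f e1 e3 e5 e6)
    (E3f (e1 + s%:~R) e3 e5 (e6 + t%:~R)) P.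
Proof.
(* Seen from e2 = 1 - e1 - e3 - e5, the lowered target is a raised one. The source is rewritten in
   terms of e2 below to match; e6 and e7 are treated likewise. *)
have down1 e : E3f (e1 - 1) e3 e5 e = E3f (1 - e1 - e3 - e5 + 1) e3 e5 e.
  rewrite -(E3f_sym_e1 (e1 - 1)).
  by have -> : 1 - (e1 - 1) - e3 - e5 = 1 - e1 - e3 - e5 + 1 by ring.
have down6 e : E3f e e3 e5 (e6 - 1) = E3f e e3 e5 (1 - e3 + e5 - e6 + 1).
  rewrite -(E3f_sym_e6 e e3 e5 (e6 - 1)).
  by have -> : 1 - e3 + e5 - (e6 - 1) = 1 - e3 + e5 - e6 + 1 by ring.
move=> [] -> [] ->; rewrite ?rmorphN1 ?rmorph1.
- exact: shift_up_up.
- by rewrite down6 -(E3f_sym_e6 e1 e3 e5 e6); exact: shift_up_up.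
- by rewrite down1 -(E3f_sym_e1 e1 e3 e5 e6); exact: shift_up_up.
- rewrite down1 down6 -(E3f_sym_e1 e1 e3 e5 e6).
  by rewrite -(E3f_sym_e6 (1 - e1 - e3 - e5) e3 e5 e6); exact: shift_up_up.
Qed.

End Shift.
End Derivation.

Lemma paramfield_pchar0 (R : realType) : [pchar paramfield R] =i pred0.
Proof.
apply/pcharf0P => m; rewrite -tofrac1 -tofracMn tofrac_eq0.
by rewrite -mpolyC_nat mpolyC_eq0 Num.Theory.pnatr_eq0.
Qed.

Theorem theorem6p2 (R : realType) (s t : int)
    (hs : s = 1 \/ s = -1) (ht : t = 1 \/ t = -1) :
  let e1 : paramfield R := param R 0 in
  let e3 : paramfield R := param R 1 in
  let e5 : paramfield R := param R 2%:R in
  let e6 : paramfield R := param R 3%:R in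
  exists P : diffop (paramfield R),
    is_shift_operator (E3f e1 e3 e5 e6) (E3f (e1 + s%:~R) e3 e5 (e6 + t%:~R)) P.
Proof. exact: E3f_shift (paramfield_pchar0 R) _ _ _ _ _ _ hs ht. Qed.
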